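(* Let $X$ and $Y$ be topological spaces and let $X\times Y$ be equipped with a $\mathcal C$-cross topology such that the family $\mathcal C$ contains a $\pi$-base for the product topology $\tau$ on $X\times Y$. Assume that $\pi(Y)<\mathrm{add}(\mathcal M_X)$ and that every non-empty open subset of $X$ is not meager in $X$. If a set $E\subseteq X\times Y$ is open and dense with respect to the product topology $\tau$, then $E$ contains a subset $G$ which is open and dense with respect to the $\mathcal C$-cross topology.
   Context: For $G\subseteq X\times Y$, $G_x=\{y\in Y:(x,y)\in G\}$ denotes the vertical section at $x\in X$ and $G^y=\{x\in X:(x,y)\in G\}$ the horizontal section at $y\in Y$. $\mathcal C$-cross topology: let $\mathcal C$ be a family of subsets of $X\times Y$ which is closed under finite intersections and such that for each $G\in\mathcal C$ every non-empty vertical section $G_x$ has non-empty interior in $Y$ and every non-empty horizontal section $G^y$ has non-empty interior in $X$. The $\mathcal C$-cross topology is the topology on $X\times Y$ generated by $\mathcal C$, for which $\mathcal C$ is a base. A $\pi$-base for a topology is a family of non-empty open sets such that every non-empty open set contains a member of the family. $\pi(Y)$ is the minimal cardinality of a $\pi$-base for $Y$. $\mathcal M_X$ is the $\sigma$-ideal of meager subsets of $X$. For a family $\mathcal F$ of subsets of a set $X$ with $X=\bigcup\mathcal F$, $\mathrm{add}(\mathcal F)$ is the minimal cardinality of a subfamily $\mathcal W\subseteq\mathcal F$ with $\bigcup\mathcal W\notin\mathcal F$. Writing an invariant presupposes that it is defined. Cardinal invariants are by convention assumed infinite (a finite value is read as $\omega$). *)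

(* Defs.v *)
From HB Require Import structures.
From mathcomp Require Import all_boot all_classical topology.

Set Implicit Arguments.
Unset Strict Implicit.
Unset Printing Implicit Defensive.

Local Open Scope classical_set_scope.
Local Open Scope card_scope.

Definition nowhere_dense (X : topologicalType) (A : set X) : Prop :=
  (closure A)° = set0.

Definition meager (X : topologicalType) (A : set X) : Prop :=
  exists2 F : nat -> set X,
    forall n, nowhere_dense (F n) & A = \bigcup_n F n.

Definition pi_base (X : topologicalType) (P : set (set X)) : Prop :=
  (forall U, P U -> open U /\ U !=set0) /\
  (forall O : set X, open O -> O !=set0 -> exists2 U, P U & U `<=` O).

(* There is no type of cardinals here: a cardinal invariant defined as a
   minimum of cardinalities is represented by any set realizing that minimum.
   All such sets are equipotent. *)
Definition min_card (T : Type) (D : set (set T)) (A : set T) : Prop :=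
  D A /\ forall B, D B -> A #<= B.

(* [B] has cardinality pi(Y), before finite values are read as omega. *)
Definition is_pi_weight (Y : topologicalType) (B : set (set Y)) : Prop :=
  min_card (@pi_base Y) B.

(* [W] has cardinality add(F).  The invariant is only defined when [F] covers
   the space and some subfamily of [F] has its union outside [F]; the second
   condition is implied by the existence of [W]. *)
Definition is_add (X : Type) (F : set (set X)) (W : set (set X)) : Prop :=
  \bigcup_(A in F) A = setT /\
  min_card [set V | V `<=` F /\ ~ F (\bigcup_(A in V) A)] W.

(* A set of cardinality |A| + omega = max(|A|, omega): cardinal invariants are
   infinite by convention, a finite value being read as omega. *)
Definition infinite_card (T : Type) (A : set T) : set (T + nat) :=
  (inl @` A) `|` range inr.

Definition card_lt (T U : Type) (A : set T) (B : set U) : Prop :=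
  A #<= B /\ ~ (B #<= A).

(* The set X * Y with the topology generated by C, instead of the product
   topology carried by [X * Y]. *)
Definition cross_space (X Y : topologicalType) (C : set (set (X * Y))) : Type :=
  (X * Y)%type.

HB.instance Definition _ (X Y : topologicalType) (C : set (set (X * Y))) :=
  Choice.copy (cross_space C) (X * Y)%type.

HB.instance Definition _ (X Y : topologicalType) (C : set (set (X * Y))) :=
  isSubBaseTopological.Build (cross_space C) C id.

Definition cross_family (X Y : topologicalType) (C : set (set (X * Y))) : Prop :=
  [/\ setI_closed C,
      basis (C : set (set (cross_space C))),
      forall G x, C G -> xsection G x !=set0 -> (xsection G x)° !=set0 &
      forall G y, C G -> ysection G y !=set0 -> (ysection G y)° !=set0].

(* Main.v *)
(** Let [G] be the union of those members of a [pi]-base of the product topology,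
    taken inside [C], that are contained in [E]; it is open for both topologies
    and dense for the product topology.  As in the Kuratowski-Ulam theorem, for
    each [B] in a [pi]-base of [Y] the projection to [X] of [G] restricted to the
    strip [X * B] is open and dense, and because [pi(Y) < add(M_X)], outside a
    meager set every [x] lies in all these projections, that is, the vertical
    section of [G] at [x] is dense.  A non-empty [H] in [C] has a horizontal
    section with non-empty interior, hence non-meager, so it contains such an
    [x]; the vertical section of [H] at [x] has non-empty interior and therefore
    meets that of [G]. *)

Require Import Defs.
From HB Require Import structures.
From mathcomp Require Import all_boot all_classical topology.

Local Open Scope classical_set_scope.
Local Open Scope card_scope.

Lemma nowhere_dense_setC (X : topologicalType) (U : set X) :
  open U -> dense U -> nowhere_dense (~` U).
Proof.
move=> oU dU; rewrite /nowhere_dense.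
have /closure_id <- : closed (~` U) by exact: open_closedC.
rewrite -subset0 => x Ix.
have [z [/interior_subset nUz Uz]] := dU (~` U)° (ex_intro _ x Ix) (@open_interior _ _).
exact: nUz.
Qed.

Lemma nowhere_dense_subset (X : topologicalType) (A B : set X) :
  A `<=` B -> nowhere_dense B -> nowhere_dense A.
Proof.
move=> AB nB; rewrite /nowhere_dense -subset0 -nB.
exact/interiorS/closureS.
Qed.

Lemma nowhere_dense_meager (X : topologicalType) (A : set X) :
  nowhere_dense A -> meager A.
Proof.
move=> nA; exists (fun=> A) => //.
by rewrite bigcup_const //; exists 0%N.
Qed.

Lemma meager_subset (X : topologicalType) (A B : set X) :
  A `<=` B -> meager B -> meager A.
Proof.
(* [meager] asks for an equality with the union, so the pieces [F n] are cut down to [A]. *)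
move=> AB [F nF BF]; exists (fun n => A `&` F n).
  by move=> n; apply: nowhere_dense_subset (nF n); exact: subIsetr.
by rewrite -setI_bigcupr -BF; apply/esym/setIidPl.
Qed.

(** An injection on [A] extends by the identity on the added copy of [nat]. *)
Lemma infinite_card_le (T : Type) (U : pointedType) (A : set T) (B : set U) :
  A #<= B -> infinite_card A #<= infinite_card B.
Proof.
move=> /pcard_leP[f].
pose h (u : T + nat) := match u with inl a => inl (f a) | inr n => inr n end.
have hinj : {in infinite_card A &, injective h}.
  have inA a : infinite_card A (inl a) -> A a by case=> [[b Ab [<-]]|[]].
  move=> [a|n] [b|m]; rewrite !inE //= => Aa Ab [].
  - by move=> fab; congr inl; apply: (@inj _ _ _ f); rewrite ?inE//; exact: inA.
  - by move=> ->.
rewrite -(card_le_eql (inj_card_eq hinj)); apply: subset_card_le.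
move=> _ [_ [[a Aa <-]|[n _ <-]] <-] /=; last by right; exists n.
by left; exists (f a) => //; exact: funS.
Qed.

(** Otherwise the image of [D] under [F] competes in the minimum defining [W], so [W] injects into
    it and hence into [D], against strictness. *)
Lemma meager_bigcup_lt_add (X : topologicalType) (I : pointedType) (D : set I)
    (F : I -> set X) (W : set (set X)) :
  is_add (@meager X) W -> card_lt (infinite_card D) (infinite_card W) ->
  (forall i, D i -> meager (F i)) -> meager (\bigcup_(i in D) F i).
Proof.
move=> [_ [_ Wmin]] [_ DW] mF; apply: contrapT => nmF; apply: DW.
have WFD : W #<= F @` D.
  apply: Wmin; split; first by move=> _ [i Di <-]; exact: mF.
  by rewrite bigcup_image.
exact/infinite_card_le/(card_le_trans WFD)/card_image_le.
Qed.

Lemma open_setX (X Y : topologicalType) (A : set X) (B : set Y) :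
  open A -> open B -> open (A `*` B).
Proof.
rewrite openE => oA; rewrite openE => oB; rewrite openE => -[x y] [/= Ax By].
by exists (A, B) => //; split; [exact: oA | exact: oB].
Qed.

Lemma strip_projection_open (X Y : topologicalType) (G : set (X * Y)) (B : set Y) :
  open G -> open B -> open (fst @` (G `&` (setT `*` B))).
Proof.
move=> oG oB; apply/fst_open/openI => //.
by apply: open_setX => //; exact: openT.
Qed.

(** For [O] open and non-empty, [G] meets the open box [O] times [B]. *)
Lemma strip_projection_dense (X Y : topologicalType) (G : set (X * Y)) (B : set Y) :
  dense G -> open B -> B !=set0 -> dense (fst @` (G `&` (setT `*` B))).
Proof.
move=> dG oB [b Bb] O [a Oa] oO.
have [[x y] [[/= Ox By] Gxy]] : (O `*` B) `&` G !=set0.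
  by apply: dG; [exists (a, b) | exact: open_setX].
by exists x; split => //; exists (x, y).
Qed.

Lemma pi_base_dense (X : topologicalType) (P : set (set X)) (A : set X) :
  pi_base P -> (forall U, P U -> U `&` A !=set0) -> dense A.
Proof.
move=> [_ Pin] PA O O0 oO; have [U PU UO] := Pin O oO O0.
by have [x [Ux Ax]] := PA U PU; exists x; split => //; exact: UO.
Qed.

Lemma meager_sections_not_dense (X Y : topologicalType) (piY : set (set Y))
    (addMX : set (set X)) (G : set (X * Y)) :
  pi_base piY -> is_add (@meager X) addMX ->
  card_lt (infinite_card piY) (infinite_card addMX) ->
  open G -> dense G -> meager [set x | ~ dense (xsection G x)].
Proof.
move=> pY addW lt oG dG.
pose N B := ~` (fst @` (G `&` (setT `*` B))).
apply: (@meager_subset _ _ (\bigcup_(B in piY) N B)).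
  (* Outside every [N B], the section at [x] meets each [B] in [piY], which suffices for density. *)
  move=> x /= ndx; apply: contrapT => xN; apply/ndx/(pi_base_dense _ _ _ pY) => B PB.
  have [[x' y] [/= Gxy [_ /= By]] /= xx'] : (fst @` (G `&` (setT `*` B))) x.
    by apply: contrapT => nx; apply: xN; exists B.
  by exists y; split => //; apply/xsectionP; rewrite -xx'.
apply: (meager_bigcup_lt_add _ _ _ _ _ addW lt) => B PB.
have [oB B0] := pY.1 B PB.
apply/nowhere_dense_meager/nowhere_dense_setC.
- exact: strip_projection_open.
- exact: strip_projection_dense.
Qed.

Theorem corollary3 (X Y : topologicalType) (C : set (set (X * Y)))
    (C_cross : cross_family C)
    (C_pi_base : exists2 P : set (set (X * Y)), P `<=` C & pi_base P)
    (piY : set (set Y)) (piYE : is_pi_weight piY)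
    (addMX : set (set X)) (addMXE : is_add (@meager X) addMX)
    (pi_lt_add : card_lt (infinite_card piY) (infinite_card addMX))
    (X_baire : forall U : set X, open U -> U !=set0 -> ~ meager U)
    (E : set (X * Y)) (E_open : open E) (E_dense : dense E) :
  exists G : set (cross_space C), [/\ G `<=` E, open G & dense G].
Proof.
have [_ [C_open C_nbhs] Cx Cy] := C_cross.
have [P PC pP] := C_pi_base; have [Popen Pin] := pP.
pose G : set (X * Y) := \bigcup_(U in [set U | P U /\ U `<=` E]) U.
have G_open : open G by apply: bigcup_open => U [/Popen[]].
have G_dense : dense G.
  apply: (pi_base_dense _ _ _ pP) => U /Popen[oU U0].
  (* Applied to [U] intersected with [E], the property of [P] yields a [V] that lies in [U] and is
     one of the sets forming [G]. *)
  have [V PV VUE] := Pin (U `&` E) (openI oU E_open) (E_dense U U0 oU).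
  have [_ [z Vz]] := Popen V PV; have [Uz _] := VUE z Vz.
  by exists z; split => //; exists V => //; split => // w /VUE[].
exists G; split.
- by move=> z [U [_ UE] /UE].
- by apply: (@bigcup_open (cross_space C)) => U [/PC/C_open].
move=> O [[x y] Oxy] O_open.
have [H [CH Hxy] HO] := C_nbhs (x, y) O (open_nbhs_nbhs (conj O_open Oxy)).
have Hy0 : (ysection H y)° !=set0 by apply: Cy => //; exists x; exact/ysectionP.
(* First move inside [H] along the horizontal line at [y]: the interior of that section is not
   meager, so some [x'] in it has a dense section of [G]. *)
have [x' Hx'y dx'] : exists2 x', H (x', y) & dense (xsection G x').
  apply: contrapT => nx'; apply: (X_baire _ (@open_interior _ _) Hy0).
  apply: meager_subset
    (meager_sections_not_dense _ _ _ _ _ piYE.1 addMXE pi_lt_add G_open G_dense).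
  by move=> x' /interior_subset/ysectionP Hx'y dx'; apply: nx'; exists x'.
have Hx0 : (xsection H x')° !=set0 by apply: Cx => //; exists y; exact/xsectionP.
(* Then move along the vertical line at [x'] to reach [G] without leaving [H]. *)
have [y' [/interior_subset/xsectionP Hy' /xsectionP Gy']] :=
  dx' _ Hx0 (@open_interior _ _).
by exists (x', y'); split => //; exact: HO.
Qed.
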